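(* $\mathsf{SD} \nleq_{soc} \mathsf{RT}^1_2$. That is, there is a set $A \subseteq \mathbb{N}$ of positive lower density such that for every set $B\subseteq \mathbb{N}$ there is an infinite set $C$ which is a subset of $B$ or of $\mathbb{N}\setminus B$ such that $C$ computes no infinite subset of $A$.
   Context: A problem is a partial function $P\colon 2^\omega \to \mathcal{P}(2^\omega)$; elements of its domain are instances, elements of $P(x)$ are solutions to $x$. $P \leq_{soc} Q$ (strong omniscient computable reducibility) means: for every $x \in \mathrm{dom}(P)$ there is some $\tilde{x} \in \mathrm{dom}(Q)$ such that for every $\tilde{y}\in Q(\tilde x)$ there is $y \leq_T \tilde y$ with $y \in P(x)$. $\mathsf{RT}^1_2$ is the problem whose instances are all sets $B\subseteq\mathbb{N}$, with solutions the infinite subsets of $B$ or of its complement. $\mathsf{SD}$ is the problem whose instances are sets $A\subseteq\mathbb{N}$ of positive lower density (lower density $\liminf_n |A\cap\{0,\ldots,n\}|/(n+1)$), with solutions the infinite subsets of $A$. *)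

(* Defs.v *)
From Stdlib Require Import Reals Arith List.
From Stdlib Require Cantor.
From Coquelicot Require Import Coquelicot.

Local Open Scope nat_scope.

(** Points of 2^omega, identified with subsets of the natural numbers. *)
Definition cantor := nat -> bool.

Definition infinite (A : cantor) : Prop :=
  forall n, exists m, n <= m /\ A m = true.

Definition subset (A B : cantor) : Prop :=
  forall n, A n = true -> B n = true.

Definition compl (A : cantor) : cantor := fun n => negb (A n).

(** Partial recursive functions relative to an oracle, in Kleene's presentation
    (basic functions, composition, primitive recursion, minimization). All
    functions are unary: several arguments are packed with the Cantor pairing,
    which is a bijection between nat * nat and nat. *)

Definition pair_nat (a b : nat) : nat := Cantor.to_nat (a, b).

Inductive code : Type :=
| cZero | cSucc | cFst | cSnd | cOracle
| cPair (f g : code)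
| cComp (f g : code)
| cPrec (f g : code)
| cMu (f : code).

(** [eval X c n y]: the function with code [c] and oracle [X] is defined at [n],
    with value [y]. In [eval_mu], the first premise says that [f] is
    defined and nonzero below [n]; [v] gives the predecessors of its values. *)
Inductive eval (X : cantor) : code -> nat -> nat -> Prop :=
| eval_zero n : eval X cZero n 0
| eval_succ n : eval X cSucc n (S n)
| eval_fst n : eval X cFst n (fst (Cantor.of_nat n))
| eval_snd n : eval X cSnd n (snd (Cantor.of_nat n))
| eval_oracle n : eval X cOracle n (Nat.b2n (X n))
| eval_pair f g n y z :
    eval X f n y -> eval X g n z -> eval X (cPair f g) n (pair_nat y z)
| eval_comp f g n y z :
    eval X g n y -> eval X f y z -> eval X (cComp f g) n z
| eval_prec0 f g n a y :
    Cantor.of_nat n = (a, 0) -> eval X f a y -> eval X (cPrec f g) n y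
| eval_precS f g n a k y z :
    Cantor.of_nat n = (a, S k) ->
    eval X (cPrec f g) (pair_nat a k) y ->
    eval X g (pair_nat a (pair_nat k y)) z ->
    eval X (cPrec f g) n z
| eval_mu f a n (v : nat -> nat) :
    (forall m, m < n -> eval X f (pair_nat a m) (S (v m))) ->
    eval X f (pair_nat a n) 0 ->
    eval X (cMu f) a n.

Definition turing_le (Y X : cantor) : Prop :=
  exists c : code, forall n, eval X c n (Nat.b2n (Y n)).

(** A partial function from 2^omega to the power set of 2^omega, given by its
    domain and its values; [sol P x] is meaningful only when [dom P x] holds. *)
Record problem : Type := Problem {
  dom : cantor -> Prop;
  sol : cantor -> cantor -> Prop
}.

Definition soc_le (P Q : problem) : Prop :=
  forall x, dom P x ->
    exists x', dom Q x' /\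
      forall y', sol Q x' y' -> exists y, turing_le y y' /\ sol P x y.

Definition RT12 : problem := {|
  dom := fun _ => True;
  sol := fun B C => infinite C /\ (subset C B \/ subset C (compl B))
|}.

Definition count_upto (A : cantor) (n : nat) : nat :=
  length (filter A (seq 0 (S n))).

Definition lower_density (A : cantor) : Rbar :=
  LimInf_seq (fun n => INR (count_upto A n) / INR (S n))%R.

Definition SD : problem := {|
  dom := fun A => Rbar_lt (Finite 0) (lower_density A);
  sol := fun A C => infinite C /\ subset C A
|}.

(* Main.v *)
(** Only the use principle for oracle computations is needed from computability.

    Given an infinite reservoir [X] and two side conditions, let [U] be the family of those [W]
    such that every cover of [X] by two pieces allows one of the two sides to be extended inside
    its piece so as to output an element of [W]. If [U] contains sets of arbitrarily small density,
    then [A] can be chosen to avoid one of them, and a suitable extension along [B] or its complement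
    outputs an element outside [A]. Otherwise, for large [N], no union of two residue classes mod [N]
    is in [U] (up to a finite part). Refine the covers witnessing this for all pairs of classes to one
    infinite piece: if both sides could still output large numbers [n0] and [n1] there, the cover for
    the classes of [n0] and [n1] would be violated. So one of the sides has finitely many outputs.

    This thinning does not depend on [B], so the reservoirs form a countable family fixed in advance
    and [A] has to meet countably many requirements, each costing a set of density as small as
    desired. *)

From Stdlib Require Import Reals Arith List Lia Lra Classical IndefiniteDescription.
From Stdlib Require Cantor.
From Coquelicot Require Import Rbar Lim_seq.
Require Import Defs.
Import ListNotations.

Local Open Scope nat_scope.

(** * Oracle computations *)

Definition agree (u : nat) (X Y : cantor) : Prop := forall x, x < u -> X x = Y x.

(** For the minimization clause below: finitely many subcomputations share a common use. *)
Lemma bounded_choice_max (P : nat -> nat -> Prop) (n : nat) :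
  (forall m u v, P m u -> u <= v -> P m v) ->
  (forall m, m < n -> exists u, P m u) ->
  exists u, forall m, m < n -> P m u.
Proof.
  intros Hmono. induction n as [|n IH]; intros H.
  - exists 0. intros; lia.
  - destruct IH as [u Hu]; [intros; apply H; lia|].
    destruct (H n) as [v Hv]; [lia|].
    exists (Nat.max u v). intros m Hm.
    destruct (Nat.eq_dec m n) as [->|].
    + apply Hmono with v; [assumption|lia].
    + apply Hmono with u; [apply Hu|]; lia.
Qed.

(** An oracle query at [n] has use [S n]; a compound computation takes the maximum over its
    subcomputations. *)
Lemma eval_use (X : cantor) (c : code) (n y : nat) :
  eval X c n y -> exists u, forall Y, agree u X Y -> eval Y c n y.
Proof.
  induction 1 as [n|n|n|n|n|f g n y z _ [u Hu] _ [v Hv]|f g n y z _ [u Hu] _ [v Hv]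
    |f g n a y E _ [u Hu]|f g n a k y z E _ [u Hu] _ [v Hv]|f a n w _ IH _ [v Hv]].
  1-4: exists 0; intros; constructor.
  - exists (S n). intros Y HY. rewrite HY by lia. constructor.
  - exists (Nat.max u v). intros Y HY.
    constructor; [apply Hu|apply Hv]; intros x Hx; apply HY; lia.
  - exists (Nat.max u v). intros Y HY.
    econstructor; [apply Hu|apply Hv]; intros x Hx; apply HY; lia.
  - exists u. intros Y HY. eapply eval_prec0; eauto.
  - exists (Nat.max u v). intros Y HY.
    eapply eval_precS; [exact E|apply Hu|apply Hv]; intros x Hx; apply HY; lia.
  - apply bounded_choice_max in IH.
    + destruct IH as [u Hu]. exists (Nat.max u v). intros Y HY.
      apply eval_mu with w.
      * intros m Hm. apply Hu; [assumption|]. intros x Hx; apply HY; lia.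
      * apply Hv. intros x Hx; apply HY; lia.
    + intros m p q Hp Hpq Y HY. apply Hp. intros x Hx; apply HY; lia.
Qed.

Lemma eval_det (X : cantor) (c : code) (n y z : nat) :
  eval X c n y -> eval X c n z -> y = z.
Proof.
  intros H; revert z.
  induction H as [n|n|n|n|n|f g n y z _ IH1 _ IH2|f g n y z _ IH1 _ IH2
    |f g n a y E _ IH|f g n a k y z E _ IH1 _ IH2|f a n w _ IH1 _ IH2];
    intros t Ht; inversion Ht; subst; try reflexivity.
  - f_equal; auto.
  - match goal with H : eval X g n ?y' |- _ => apply IH1 in H; subst end. auto.
  - apply IH. congruence.
  - congruence.
  - congruence.
  - match goal with H : Cantor.of_nat n = _ |- _ => rewrite E in H; injection H as <- <- end.
    match goal with H : eval X (cPrec f g) _ ?y' |- _ => apply IH1 in H; subst end. auto.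
  (* At the smaller of two distinct minima, [f] would take both the value 0 and a successor. *)
  - destruct (lt_eq_lt_dec n t) as [[Hlt| ->]|Hlt]; [|reflexivity|].
    + match goal with H : forall m, m < t -> _ |- _ => apply H, IH2 in Hlt end. discriminate.
    + specialize (IH1 _ Hlt _ ltac:(eassumption)). discriminate.
Qed.

Lemma eval_true (X Y : cantor) (c : code) (n : nat) :
  (forall n, eval X c n (Nat.b2n (Y n))) -> (eval X c n 1 <-> Y n = true).
Proof.
  intros H. specialize (H n). split.
  - intros H1. assert (E := eval_det _ _ _ _ _ H H1). now destruct (Y n).
  - intros E. now rewrite E in H.
Qed.

(** * Countability *)

Definition countable (T : Type) : Prop :=
  exists f : T -> nat, forall x y, f x = f y -> x = y.

Lemma countable_surjection (T : Type) (t0 : T) :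
  countable T -> exists g : nat -> T, forall t, exists n, g n = t.
Proof.
  intros [f Hf].
  destruct (functional_choice (fun n t => (exists t', f t' = n) -> f t = n)) as [g Hg].
  - intros n. destruct (classic (exists t, f t = n)) as [[t Ht]|H].
    + now exists t.
    + now exists t0.
  - exists g. intros t. exists (f t). apply Hf, Hg. now exists t.
Qed.

Lemma countable_nat : countable nat.
Proof. now exists (fun n => n). Qed.

Lemma countable_sum (S T : Type) : countable S -> countable T -> countable (S + T).
Proof.
  intros [f Hf] [g Hg].
  exists (fun p => match p with inl a => 2 * f a | inr b => 2 * g b + 1 end).
  intros [a|a] [b|b] E; try (exfalso; lia); f_equal; [apply Hf|apply Hg]; lia.
Qed.

Lemma countable_prod (S T : Type) : countable S -> countable T -> countable (S * T).
Proof.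
  intros [f Hf] [g Hg]. exists (fun p => Cantor.to_nat (f (fst p), g (snd p))).
  intros [a b] [c d] E. apply Cantor.to_nat_inj in E. injection E as E1 E2.
  f_equal; auto.
Qed.

Lemma countable_list (T : Type) : countable T -> countable (list T).
Proof.
  intros [f Hf].
  exists (fix enc l := match l with [] => 0 | x :: l => S (Cantor.to_nat (f x, enc l)) end).
  intros l; induction l as [|x l IH]; intros [|y m] E; try discriminate; [reflexivity|].
  apply Nat.succ_inj, Cantor.to_nat_inj in E. injection E as E1 E2.
  f_equal; auto.
Qed.

Fixpoint code_index (c : code) : nat :=
  match c with
  | cZero => pair_nat 0 0
  | cSucc => pair_nat 1 0
  | cFst => pair_nat 2 0
  | cSnd => pair_nat 3 0
  | cOracle => pair_nat 4 0
  | cPair f g => pair_nat 5 (pair_nat (code_index f) (code_index g))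
  | cComp f g => pair_nat 6 (pair_nat (code_index f) (code_index g))
  | cPrec f g => pair_nat 7 (pair_nat (code_index f) (code_index g))
  | cMu f => pair_nat 8 (code_index f)
  end.

Lemma pair_nat_inj (a b c d : nat) : pair_nat a b = pair_nat c d -> a = c /\ b = d.
Proof. unfold pair_nat. intros E. apply Cantor.to_nat_inj in E. now injection E. Qed.

Lemma countable_code : countable code.
Proof.
  exists code_index.
  intros c; induction c; intros []; cbn [code_index]; intros E;
    apply pair_nat_inj in E; destruct E as [E1 E2]; try discriminate; try reflexivity;
    try (apply pair_nat_inj in E2; destruct E2); f_equal; auto.
Qed.

(** * Sparse sets *)

(** The bound holds at every [n], not only in the limit, so all elements are at least
    [2 ^ r - 1]. *)
Definition sparse (r : nat) (W : cantor) : Prop :=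
  forall n, 2 ^ r * count_upto W n <= S n.

Definition has_sparse (U : cantor -> Prop) : Prop :=
  forall r, exists W, sparse r W /\ U W.

Lemma count_upto_S (W : cantor) (n : nat) :
  count_upto W (S n) = count_upto W n + Nat.b2n (W (S n)).
Proof.
  unfold count_upto. rewrite (seq_S (S n)), filter_app, length_app. cbn [filter plus].
  now destruct (W (S n)).
Qed.

Lemma count_upto_0 (W : cantor) : count_upto W 0 = Nat.b2n (W 0).
Proof. unfold count_upto. simpl. now destruct (W 0). Qed.

Lemma count_upto_le (V W : cantor) (n : nat) :
  (forall x, x <= n -> V x = true -> W x = true) -> count_upto V n <= count_upto W n.
Proof.
  assert (B : forall a b : bool, (a = true -> b = true) -> Nat.b2n a <= Nat.b2n b).
  { intros [] [] Hab; simpl; lia. }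
  induction n as [|n IH]; intros H.
  - rewrite !count_upto_0. apply B, H. lia.
  - rewrite !count_upto_S. apply Nat.add_le_mono; [|apply B, H; lia].
    apply IH. intros x Hx. apply H. lia.
Qed.

Lemma count_upto_orb (V W : cantor) (n : nat) :
  count_upto (fun x => orb (V x) (W x)) n <= count_upto V n + count_upto W n.
Proof.
  induction n as [|n IH].
  - rewrite !count_upto_0. destruct (V 0), (W 0); simpl; lia.
  - rewrite !count_upto_S. destruct (V (S n)), (W (S n)); simpl; lia.
Qed.

Lemma count_upto_compl (W : cantor) (n : nat) :
  count_upto W n + count_upto (compl W) n = S n.
Proof.
  induction n as [|n IH].
  - rewrite !count_upto_0. unfold compl. now destruct (W 0).
  - rewrite !count_upto_S. unfold compl in *. destruct (W (S n)); simpl; lia.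
Qed.

Lemma count_upto_pos (W : cantor) (n : nat) : W n = true -> 1 <= count_upto W n.
Proof.
  intros H. destruct n.
  - now rewrite count_upto_0, H.
  - rewrite count_upto_S, H. simpl. lia.
Qed.

Lemma count_upto_empty (n : nat) : count_upto (fun _ => false) n = 0.
Proof. induction n as [|n IH]; [reflexivity|]. now rewrite count_upto_S, IH. Qed.

Lemma sparse_empty (r : nat) : sparse r (fun _ => false).
Proof. intros n. rewrite count_upto_empty. lia. Qed.

Lemma sparse_singleton (r a : nat) : 2 ^ r <= a -> sparse r (Nat.eqb a).
Proof.
  intros Ha n.
  assert (C : count_upto (Nat.eqb a) n = if a <=? n then 1 else 0).
  { induction n as [|n IH].
    - rewrite count_upto_0. now destruct a.
    - rewrite count_upto_S, IH.
      destruct (Nat.eqb_spec a (S n)), (Nat.leb_spec a n), (Nat.leb_spec a (S n)); simpl; lia. }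
  rewrite C. destruct (Nat.leb_spec a n); lia.
Qed.

(** Cut off below [N], since a small element may break [sparse] on short initial segments. *)
Definition class_mod (N a : nat) : cantor := fun n => andb (N <=? n) (n mod N =? a).

Lemma count_upto_class_mod (N a n : nat) :
  a < N -> count_upto (class_mod N a) n <= (n - a) / N.
Proof.
  intros Ha. induction n as [|n IH].
  - rewrite count_upto_0. unfold class_mod. destruct (Nat.leb_spec N 0); simpl; lia.
  - rewrite count_upto_S. unfold class_mod at 2.
    assert (M : (n - a) / N <= (S n - a) / N) by (apply Nat.Div0.div_le_mono; lia).
    destruct (Nat.leb_spec N (S n)) as [HN|]; cbn [andb Nat.b2n]; [|lia].
    destruct (Nat.eqb_spec (S n mod N) a) as [E|]; cbn [andb Nat.b2n]; [|lia].
    assert (D := Nat.div_mod_eq (S n) N). rewrite E in D.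
    destruct (S n / N) as [|q]; [lia|].
    assert (E1 : (n - a) / N = q) by (symmetry; apply Nat.div_unique with (N - 1); lia).
    assert (E2 : (S n - a) / N = S q) by (symmetry; apply Nat.div_unique with 0; lia).
    lia.
Qed.

Definition two_classes (N a b : nat) : cantor := fun n => orb (class_mod N a n) (class_mod N b n).

(** Each class has density [1 / 2 ^ S r], so the two together have [1 / 2 ^ r]. *)
Lemma sparse_two_classes (r a b : nat) :
  a < 2 ^ S r -> b < 2 ^ S r -> sparse r (two_classes (2 ^ S r) a b).
Proof.
  intros Ha Hb n.
  assert (Ca := count_upto_class_mod _ _ n Ha). assert (Cb := count_upto_class_mod _ _ n Hb).
  assert (C := count_upto_orb (class_mod (2 ^ S r) a) (class_mod (2 ^ S r) b) n).
  assert (Da := Nat.Div0.mul_div_le (n - a) (2 ^ S r)).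
  assert (Db := Nat.Div0.mul_div_le (n - b) (2 ^ S r)).
  fold (two_classes (2 ^ S r) a b) in C.
  rewrite Nat.pow_succ_r' in *. nia.
Qed.

Lemma positive_lower_density (A : cantor) :
  (forall n, 2 * count_upto (compl A) n <= S n) -> Rbar_lt (Finite 0) (lower_density A).
Proof.
  intros H. apply Rbar_lt_le_trans with (Finite (1 / 2)); [simpl; lra|].
  rewrite <- (LimInf_seq_const (1 / 2)). apply LimInf_le. exists 0. intros n _.
  assert (C : S n <= 2 * count_upto A n) by (specialize (H n); pose proof (count_upto_compl A n); lia).
  apply le_INR in C. rewrite mult_INR in C. simpl (INR 2) in C.
  assert (P : (0 < INR (S n))%R) by (apply lt_0_INR; lia).
  apply Rmult_le_reg_r with (INR (S n)); [assumption|].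
  unfold Rdiv at 2. rewrite Rmult_assoc, Rinv_l by lra. lra.
Qed.

(** The complement of [A] is a union of one set per family. The set for [U r] costs density at most
    [1 / 2 ^ (r + 2)], for a total of at most 1/2. *)
Lemma dense_set_avoiding (U : nat -> cantor -> Prop) :
  exists A, Rbar_lt (Finite 0) (lower_density A) /\
    forall r, has_sparse (U r) -> exists W, U r W /\ forall n, W n = true -> A n = false.
Proof.
  destruct (functional_choice (fun r W => sparse (r + 2) W /\ (has_sparse (U r) -> U r W)))
    as [W HW].
  { intros r. destruct (classic (has_sparse (U r))) as [H|H].
    - destruct (H (r + 2)) as [W HW]. exists W. tauto.
    - exists (fun _ => false). split; [apply sparse_empty|tauto]. }
  set (V := fun k n => existsb (fun r => W r n) (seq 0 k)).
  (* Geometric sum, cleared of denominators: the density of [V k] is at most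
     [1 / 2 - 1 / 2 ^ (k + 1)] on every initial segment. *)
  assert (HV : forall k n, 2 ^ (k + 1) * count_upto (V k) n + S n <= 2 ^ k * S n).
  { intros k n. induction k as [|k IH].
    - change (V 0) with (fun _ : nat => false). rewrite count_upto_empty. simpl; lia.
    - assert (C : count_upto (V (S k)) n <= count_upto (V k) n + count_upto (W k) n).
      { etransitivity; [|apply count_upto_orb]. apply count_upto_le. intros x _.
        unfold V. rewrite seq_S, existsb_app. simpl. now rewrite Bool.orb_false_r. }
      destruct (HW k) as [Hs _]. specialize (Hs n).
      replace (k + 2) with (S (S k)) in Hs by lia.
      replace (k + 1) with (S k) in IH by lia. replace (S k + 1) with (S (S k)) by lia.
      rewrite !Nat.pow_succ_r' in *. nia. }
  (* Only [W 0] to [W n] are consulted at [n]: a later [W r] is too sparse to contain [n]. *)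
  exists (fun n => negb (V (S n) n)). split.
  - apply positive_lower_density. intros n.
    assert (C : count_upto (compl (fun n => negb (V (S n) n))) n <= count_upto (V (S n)) n).
    { apply count_upto_le. intros x Hx. unfold compl. rewrite Bool.negb_involutive. unfold V.
      rewrite !existsb_exists. intros [r [Hr E]]. exists r. split; [|assumption].
      apply in_seq in Hr. apply in_seq. lia. }
    specialize (HV (S n) n). rewrite Nat.add_1_r, Nat.pow_succ_r' in HV.
    assert (P : 2 ^ S n <> 0) by (apply Nat.pow_nonzero; lia).
    nia.
  - intros r Hr. destruct (HW r) as [Hs HU]. exists (W r). split; [auto|].
    intros n Hn. apply Bool.negb_false_iff. unfold V. apply existsb_exists.
    exists r. split; [|assumption]. apply in_seq. split; [lia|].
    specialize (Hs n). apply count_upto_pos in Hn.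
    assert (r + 2 < 2 ^ (r + 2)) by (apply Nat.pow_gt_lin_r; lia). nia.
Qed.

(** * Thinning a reservoir *)

Definition of_list (l : list nat) : cantor := fun x => existsb (Nat.eqb x) l.

Lemma of_list_true (l : list nat) (x : nat) : of_list l x = true <-> In x l.
Proof.
  unfold of_list. rewrite existsb_exists. split.
  - intros [y [Hy E]]. apply Nat.eqb_eq in E. now subst.
  - intros H. exists x. split; [assumption|apply Nat.eqb_refl].
Qed.

(** A finite part and a functional for each of the two sides, and a bound below which nothing may
    be added any more. *)
Definition data : Type := ((list nat * code) * (list nat * code)) * nat.

Definition stem (d : data) (c : bool) : list nat :=
  fst (if c then fst (fst d) else snd (fst d)).
Definition functional (d : data) (c : bool) : code :=
  snd (if c then fst (fst d) else snd (fst d)).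
Definition bound (d : data) : nat := snd d.

Definition outputs (d : data) (c : bool) (E : list nat) (n : nat) : Prop :=
  eval (of_list (stem d c ++ E)) (functional d c) n 1.

Definition within (X : cantor) (u : nat) (E : list nat) : Prop :=
  forall x, In x E -> u <= x /\ X x = true.

(** The family called [U] in the overview. *)
Definition unavoidable (X : cantor) (d : data) (W : cantor) : Prop :=
  forall Z : bool -> cantor, (forall x, exists c, Z c x = true) ->
    exists c E n, within X (bound d) E /\ (forall x, In x E -> Z c x = true) /\
      W n = true /\ outputs d c E n.

Definition silenced (X : cantor) (d : data) : Prop :=
  exists c m, forall E n, within X (bound d) E -> m <= n -> ~ outputs d c E n.

Lemma infinite_split (X Y Z : cantor) :
  infinite X -> (forall x, Y x = true \/ Z x = true) ->
  infinite (fun x => andb (X x) (Y x)) \/ infinite (fun x => andb (X x) (Z x)).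
Proof.
  intros HX HYZ. apply NNPP. intros H. apply not_or_and in H. destruct H as [H1 H2].
  apply not_all_ex_not in H1, H2. destruct H1 as [a Ha], H2 as [b Hb].
  destruct (HX (Nat.max a b)) as [m [Hm Xm]].
  destruct (HYZ m) as [E|E]; [apply Ha|apply Hb]; exists m; rewrite Xm, E; split; trivial; lia.
Qed.

(** Pigeonhole, one cover at a time: some side keeps infinitely many elements. *)
Lemma common_refinement (I : Type) (Z : I -> bool -> cantor) (L : list I) (X : cantor) :
  (forall i, In i L -> forall x, exists c, Z i c x = true) -> infinite X ->
  exists X', infinite X' /\ subset X' X /\ forall i, In i L -> exists c, subset X' (Z i c).
Proof.
  intros HZ HX. induction L as [|i L IH].
  - exists X. repeat split; [assumption|now intros x|intros _ []].
  - destruct IH as [X' [H1 [H2 H3]]]; [intros; apply HZ; now right|].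
    assert (exists c, infinite (fun x => andb (X' x) (Z i c x))) as [c Hc].
    { destruct (infinite_split X' (Z i true) (Z i false)) as [H|H]; [assumption| |eauto|eauto].
      intros x. destruct (HZ i (or_introl eq_refl) x) as [[] E]; auto. }
    exists (fun x => andb (X' x) (Z i c x)). repeat split; [assumption| |].
    + intros x E. apply andb_prop in E. now apply H2.
    + intros j [<-|Hj].
      * exists c. intros x E. now apply andb_prop in E.
      * destruct (H3 j Hj) as [c' Hc']. exists c'. intros x E. apply andb_prop in E. now apply Hc'.
Qed.

Lemma class_mod_refl (N n : nat) : N <= n -> class_mod N (n mod N) n = true.
Proof.
  intros H. unfold class_mod. apply Nat.leb_le in H. now rewrite H, Nat.eqb_refl.
Qed.

Lemma silencing (X : cantor) (d : data) :
  infinite X -> ~ has_sparse (unavoidable X d) ->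
  exists X', infinite X' /\ subset X' X /\ silenced X' d.
Proof.
  intros HX HU. apply not_all_ex_not in HU. destruct HU as [r Hr].
  set (N := 2 ^ S r).
  assert (N0 : N <> 0) by (apply Nat.pow_nonzero; lia).
  (* [Z] assigns to each pair of residues a cover witnessing that their two classes, though sparse
     enough, do not form an unavoidable set. *)
  destruct (functional_choice (fun p Z => fst p < N -> snd p < N ->
     (forall x, exists c : bool, Z c x = true) /\
     forall c E n, within X (bound d) E -> (forall x, In x E -> Z c x = true) ->
      two_classes N (fst p) (snd p) n = true -> ~ outputs d c E n)) as [Z HZ].
  { intros [a b]. simpl. apply NNPP. intros H. apply Hr.
    destruct (classic (a < N /\ b < N)) as [[Ha Hb]|Hab].
    2: { exfalso. apply H. exists (fun _ _ => true). tauto. }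
    exists (two_classes N a b). split; [now apply sparse_two_classes|].
    intros Z HZ. apply NNPP. intros HE. apply H. exists Z. intros _ _. split; [assumption|].
    intros c E n H1 H2 H3 H4. apply HE. now exists c, E, n. }
  destruct (common_refinement _ Z (list_prod (seq 0 N) (seq 0 N)) X) as [X' [H1 [H2 H3]]].
  { intros [a b] Hp. apply in_prod_iff in Hp. destruct Hp as [Ha Hb].
    apply in_seq in Ha, Hb. apply HZ; simpl; lia. }
  { assumption. }
  exists X'. split; [assumption|]. split; [assumption|]. apply NNPP. intros HS.
  assert (HO : forall c, exists E n, within X' (bound d) E /\ N <= n /\ outputs d c E n).
  { intros c. apply NNPP. intros H. apply HS. exists c, N. intros E n HE Hn Ho.
    apply H. now exists E, n. }
  destruct (HO true) as [E1 [n1 [W1 [L1 O1]]]], (HO false) as [E0 [n0 [W0 [L0 O0]]]].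
  assert (M1 := Nat.mod_upper_bound n1 N N0). assert (M0 := Nat.mod_upper_bound n0 N N0).
  (* The side [c] containing [X'] is known only once the cover is fixed, so the pair records the
     residues of the outputs of both sides. *)
  destruct (H3 (n1 mod N, n0 mod N)) as [c Hc].
  { apply in_prod_iff. rewrite !in_seq. lia. }
  destruct (HZ (n1 mod N, n0 mod N) M1 M0) as [_ HZ']. simpl in HZ'.
  unfold two_classes in HZ'.
  destruct c; [apply (HZ' true E1 n1)|apply (HZ' false E0 n0)]; auto.
  1, 4: intros x Hx; split; [now apply W1 + now apply W0|apply H2; now apply W1 + now apply W0].
  1, 3: intros x Hx; apply Hc; now apply W1 + now apply W0.
  - now rewrite class_mod_refl.
  - rewrite (class_mod_refl N n0) by assumption. apply Bool.orb_true_r.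
Qed.

(** A list records the thinnings made so far, latest first, starting from all of [nat]. *)
Lemma reservoirs :
  exists R : list data -> cantor,
    (forall l, infinite (R l)) /\
    (forall d l, subset (R (d :: l)) (R l)) /\
    (forall d l, ~ has_sparse (unavoidable (R l) d) -> silenced (R (d :: l)) d).
Proof.
  destruct (functional_choice (fun (p : data * cantor) X' => infinite (snd p) ->
    infinite X' /\ subset X' (snd p) /\
    (~ has_sparse (unavoidable (snd p) (fst p)) -> silenced X' (fst p)))) as [T HT].
  { intros [d X]. simpl. destruct (classic (infinite X)) as [HX|]; [|exists X; tauto].
    destruct (classic (has_sparse (unavoidable X d))) as [H|H].
    - exists X. repeat split; try tauto. now intros x.
    - destruct (silencing X d HX H) as [X' HX']. exists X'. tauto. }
  set (R := fold_right (fun d X => T (d, X)) (fun _ => true)).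
  assert (HR : forall l, infinite (R l)).
  { induction l as [|d l IH].
    - intros n. exists n. split; [lia|reflexivity].
    - now apply (HT (d, R l)). }
  exists R. split; [assumption|]. split; intros d l; now apply (HT (d, R l) (HR l)).
Qed.

(** * Mathias forcing along [B] *)

(** A Mathias condition with two finite parts and a common reservoir: the numbers from [level] on in
    the reservoir at [address]. *)
Record condition : Type := Condition {
  part : bool -> list nat;
  level : nat;
  address : list data
}.

Definition side (B : cantor) (c : bool) : cantor := if c then B else compl B.

Definition valid (B : cantor) (s : condition) : Prop :=
  forall c x, In x (part s c) -> x < level s /\ side B c x = true.

Definition extends (R : list data -> cantor) (s s' : condition) : Prop :=
  level s <= level s' /\ subset (R (address s')) (R (address s)) /\
  forall c, exists E, part s' c = part s c ++ E /\ within (R (address s)) (level s) E.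

(** Either a computation with use below [level] puts out an element outside [A], or the outputs over
    all extensions are bounded. *)
Definition forces (R : list data -> cantor) (A : cantor) (e : bool -> code) (s : condition) : Prop :=
  exists c,
    (exists n, A n = false /\
       forall G, agree (level s) (of_list (part s c)) G -> eval G (e c) n 1) \/
    (exists m, forall E n, within (R (address s)) (level s) E -> m <= n ->
       ~ eval (of_list (part s c ++ E)) (e c) n 1).

Definition grows (s s' : condition) : Prop :=
  forall c, exists x, In x (part s' c) /\ level s <= x.

Definition avoids (R : list data -> cantor) (A : cantor) : Prop :=
  forall l d, has_sparse (unavoidable (R l) d) ->
    exists W, unavoidable (R l) d W /\ forall n, W n = true -> A n = false.

(** With this, both finite parts can always grow; its failure puts a tail of some reservoir inside
    one side. *)
Definition splits (R : list data -> cantor) (B : cantor) : Prop :=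
  forall l u c, exists x, u <= x /\ R l x = true /\ side B c x = true.

Lemma within_weaken (X Y : cantor) (u v : nat) (E : list nat) :
  subset X Y -> v <= u -> within X u E -> within Y v E.
Proof. intros H1 H2 H x Hx. destruct (H x Hx). split; [lia|auto]. Qed.

Lemma within_app (X : cantor) (u : nat) (E E' : list nat) :
  within X u E -> within X u E' -> within X u (E ++ E').
Proof. intros H1 H2 x Hx. apply in_app_or in Hx. destruct Hx; auto. Qed.

Lemma extends_trans (R : list data -> cantor) (s t w : condition) :
  extends R s t -> extends R t w -> extends R s w.
Proof.
  intros [L1 [S1 E1]] [L2 [S2 E2]]. split; [lia|]. split.
  - intros x Hx. auto.
  - intros c. destruct (E1 c) as [E [H1 H1']], (E2 c) as [E' [H2 H2']].
    exists (E ++ E'). split; [now rewrite H2, H1, app_assoc|].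
    apply within_app; [assumption|]. now apply within_weaken with (R (address t)) (level t).
Qed.

Lemma extends_agree (R : list data -> cantor) (s t : condition) (c : bool) :
  extends R s t -> agree (level s) (of_list (part s c)) (of_list (part t c)).
Proof.
  intros [_ [_ H]] x Hx. destruct (H c) as [E [-> HE]].
  apply Bool.eq_true_iff_eq. rewrite !of_list_true, in_app_iff. split; [tauto|].
  intros [|HxE]; [assumption|]. apply HE in HxE. lia.
Qed.

(** Bits below [level] are frozen, and every extension of [t] also extends [s]. *)
Lemma forces_extends (R : list data -> cantor) (A : cantor) (e : bool -> code) (s t : condition) :
  forces R A e s -> extends R s t -> forces R A e t.
Proof.
  intros [c Hc] Hst. exists c. assert (Hag := extends_agree _ _ _ c Hst).
  destruct Hst as [L [S1 HE]].
  destruct Hc as [[n [An Hn]]|[m Hm]]; [left; exists n|right; exists m].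
  - split; [assumption|]. intros G HG. apply Hn. intros x Hx.
    rewrite Hag by assumption. apply HG. lia.
  - intros E n HEw Hmn. destruct (HE c) as [E' [-> HE']]. rewrite <- app_assoc.
    apply Hm; [|assumption]. apply within_app; [assumption|].
    now apply within_weaken with (R (address t)) (level t).
Qed.

Definition set_side {T : Type} (f : bool -> T) (c : bool) (y : T) : bool -> T :=
  fun c' => if Bool.eqb c' c then y else f c'.

Lemma grow (R : list data -> cantor) (B : cantor) (s : condition) :
  splits R B -> valid B s -> exists s', valid B s' /\ extends R s s' /\ grows s s'.
Proof.
  intros HB Hs. destruct (functional_choice _ (HB (address s) (level s))) as [x Hx].
  exists (Condition (fun c => part s c ++ [x c])
    (S (Nat.max (x true) (x false))) (address s)).
  assert (Hl : forall c, x c <= Nat.max (x true) (x false)) by (intros []; lia).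
  split; [|split].
  - intros c y Hy. simpl in *. apply in_app_or in Hy. destruct Hy as [Hy|[<-|[]]].
    + apply Hs in Hy. specialize (Hl c). destruct (Hx c). split; [lia|tauto].
    + specialize (Hl c). split; [lia|apply Hx].
  - split; [|split]; simpl.
    + specialize (Hl true). destruct (Hx true). lia.
    + now intros y.
    + intros c. exists [x c]. split; [reflexivity|]. intros y [<-|[]]. now split; apply Hx.
  - intros c. exists (x c). split; [|apply Hx]. simpl. apply in_or_app. simpl. tauto.
Qed.

(** If there are sparse unavoidable sets, one finite part is extended; otherwise the address is
    lengthened. *)
Lemma decide (R : list data -> cantor) (A B : cantor) (s : condition) (e : bool -> code) :
  (forall d l, subset (R (d :: l)) (R l)) ->
  (forall d l, ~ has_sparse (unavoidable (R l) d) -> silenced (R (d :: l)) d) ->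
  avoids R A -> valid B s ->
  exists s', valid B s' /\ extends R s s' /\ forces R A e s'.
Proof.
  intros Hsub Hsil HA Hs.
  set (d := (((part s true, e true), (part s false, e false)), level s) : data).
  assert (Hd : forall c, stem d c = part s c /\ functional d c = e c) by now intros [].
  assert (refl : forall c, exists E, part s c = part s c ++ E /\
    within (R (address s)) (level s) E).
  { intros c. exists []. split; [symmetry; apply app_nil_r|intros x []]. }
  destruct (classic (has_sparse (unavoidable (R (address s)) d))) as [H|H].
  - destruct (HA _ _ H) as [W [HW HWA]].
    (* With the cover by [B] and its complement, the extension [E] stays on its own side. *)
    destruct (HW (side B)) as [c [E [n [HE [HEB [Wn On]]]]]].
    { intros x. unfold side, compl. destruct (B x) eqn:Bx; [exists true|exists false]; simpl;
        now rewrite Bx. }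
    unfold outputs in On. destruct (Hd c) as [-> ->] in On.
    destruct (eval_use _ _ _ _ On) as [u Hu].
    (* Above the use, to preserve the computation, and above [E], for validity. *)
    set (v := S (Nat.max (Nat.max u (level s)) (list_max E))).
    exists (Condition (set_side (part s) c (part s c ++ E)) v (address s)).
    assert (HEv : forall x, In x E -> x < v).
    { intros x Hx. assert (F := proj1 (list_max_le E (list_max E)) (le_n _)).
      rewrite Forall_forall in F. specialize (F x Hx). unfold v. lia. }
    split; [|split].
    + intros c' x. simpl. unfold set_side.
      destruct (Bool.eqb_spec c' c) as [->|_]; [rewrite in_app_iff; intros [Hx|Hx]|intros Hx].
      * apply Hs in Hx. split; [unfold v; lia|tauto].
      * auto.
      * apply Hs in Hx. split; [unfold v; lia|tauto].
    + split; [unfold v; simpl; lia|]. split; [now intros x|].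
      intros c'. simpl. unfold set_side. destruct (Bool.eqb_spec c' c) as [->|_]; [|auto].
      now exists E.
    + exists c. left. exists n. split; [auto|]. simpl. unfold set_side.
      rewrite Bool.eqb_reflx. intros G HG. apply Hu. intros x Hx. apply HG. unfold v. lia.
  - destruct (Hsil _ _ H) as [c [m Hm]].
    exists (Condition (part s) (level s) (d :: address s)).
    split; [assumption|]. split.
    + split; [apply le_n|]. split; [apply Hsub|assumption].
    + exists c. right. exists m. intros E n HE Hmn. specialize (Hm E n HE Hmn).
      unfold outputs in Hm. now destruct (Hd c) as [-> ->] in Hm.
Qed.

(** Conditions are extended along an enumeration of all pairs of codes. Defeating one code of each
    pair suffices, as a reduction supplies a code for each side. *)
Lemma generic_pair (R : list data -> cantor) (A B : cantor) :
  (forall d l, subset (R (d :: l)) (R l)) ->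
  (forall d l, ~ has_sparse (unavoidable (R l) d) -> silenced (R (d :: l)) d) ->
  avoids R A -> splits R B ->
  exists G : bool -> cantor,
    (forall c, infinite (G c) /\ subset (G c) (side B c)) /\
    forall e : bool -> code, exists c,
      (exists n, A n = false /\ eval (G c) (e c) n 1) \/
      (exists m, forall n, m <= n -> ~ eval (G c) (e c) n 1).
Proof.
  intros Hsub Hsil HA HB.
  destruct (countable_surjection (code * code) (cZero, cZero)) as [req Hreq].
  { apply countable_prod; apply countable_code. }
  set (e := fun k (c : bool) => if c then fst (req k) else snd (req k)).
  destruct (functional_choice (fun (p : nat * condition) s' => valid B (snd p) ->
    valid B s' /\ extends R (snd p) s' /\ grows (snd p) s' /\ forces R A (e (fst p)) s'))
    as [next Hnext].
  { intros [k s]. simpl. destruct (classic (valid B s)) as [Hs|]; [|now exists s].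
    destruct (decide R A B s (e k)) as [s1 [V1 [X1 F1]]]; try assumption.
    destruct (grow R B s1) as [s2 [V2 [X2 G2]]]; try assumption.
    exists s2. intros _. split; [assumption|]. split; [now apply extends_trans with s1|]. split.
    - intros c. destruct (G2 c) as [x [Hx Lx]]. exists x. split; [assumption|].
      destruct X1. lia.
    - now apply forces_extends with s1. }
  set (s := nat_rect (fun _ => condition) (Condition (fun _ => []) 0 [])
    (fun k t => next (k, t))).
  assert (Hv : forall k, valid B (s k)).
  { induction k as [|k IH]; [intros c x []|]. now apply (Hnext (k, s k)). }
  assert (Hx : forall k j, extends R (s k) (s (j + k))).
  { intros k j. induction j as [|j IH].
    - split; [apply le_n|]. split; [now intros x|].
      intros c. exists []. split; [symmetry; apply app_nil_r|intros x []].
    - apply extends_trans with (s (j + k)); [assumption|].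
      exact (proj1 (proj2 (Hnext (j + k, s (j + k)) (Hv (j + k))))). }
  assert (Hg : forall k, grows (s k) (s (S k))) by 
    exact (fun k => proj1 (proj2 (proj2 (Hnext (k, s k) (Hv k))))).
  assert (Hl : forall k, k <= level (s k)).
  { induction k as [|k IH]; [lia|]. destruct (Hg k true) as [x [Hin Lx]].
    apply Hv in Hin. lia. }
  (* The level at stage [S x] exceeds [x], so membership of [x] is final there. *)
  set (G := fun c x => of_list (part (s (S x)) c) x).
  assert (HG : forall k c, agree (level (s k)) (of_list (part (s k) c)) (G c)).
  { intros k c x Hxk. unfold G. assert (Lx := Hl (S x)).
    destruct (Nat.le_ge_cases k (S x)) as [Hk|Hk].
    - replace (S x) with ((S x - k) + k) by lia. apply (extends_agree R); [apply Hx|assumption].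
    - symmetry. replace k with ((k - S x) + S x) by lia.
      apply (extends_agree R); [apply Hx|lia]. }
  exists G. split.
  - intros c. split.
    + intros n. destruct (Hg n c) as [x [Hin Lx]]. exists x.
      specialize (Hl n). split; [lia|].
      rewrite <- (HG (S n) c); [now apply of_list_true|now apply Hv in Hin].
    + intros x Hxc. apply of_list_true in Hxc. now apply Hv in Hxc.
  - intros f. destruct (Hreq (f true, f false)) as [k Hk].
    assert (Hf : forall c, e k c = f c) by (intros []; unfold e; now rewrite Hk).
    assert (F : forces R A (e k) (s (S k))) by apply (Hnext (k, s k) (Hv k)).
    destruct F as [c F]. rewrite Hf in F. exists c.
    destruct F as [[n [An Hn]]|[m Hm]]; [left; exists n|right; exists m].
    + split; [assumption|]. apply Hn, HG.
    (* With use [u], the output already arises from the finite part at stage [u + S k], which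
       extends the one at stage [S k]. *)
    + intros n Hmn Hev. destruct (eval_use _ _ _ _ Hev) as [u Hu].
      destruct (Hx (S k) u) as [_ [_ HE]]. destruct (HE c) as [E [HE1 HE2]].
      apply (Hm E n HE2 Hmn). rewrite <- HE1. apply Hu. intros x Hxu. symmetry.
      apply HG. specialize (Hl (u + S k)). lia.
Qed.

(** * Tails of reservoirs inside one side, and the conclusion *)

Definition tail (u : nat) (X : cantor) : cantor := fun x => andb (u <=? x) (X x).

Lemma infinite_tail (u : nat) (X : cantor) : infinite X -> infinite (tail u X).
Proof.
  intros H n. destruct (H (Nat.max u n)) as [m [Hm Xm]]. exists m. split; [lia|].
  unfold tail. rewrite Xm, Bool.andb_true_r. apply Nat.leb_le. lia.
Qed.

(** If [A] is disjoint from a member of this family, some output of [e] lies outside [A]. *)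
Definition hit_by (X : cantor) (e : code) (W : cantor) : Prop :=
  exists n, W n = true /\ eval X e n 1.

Lemma has_sparse_hit_by (X Y : cantor) (e : code) :
  infinite Y -> (forall n, eval X e n (Nat.b2n (Y n))) -> has_sparse (hit_by X e).
Proof.
  intros HY He r. destruct (HY (2 ^ r)) as [n [Hn Yn]]. exists (Nat.eqb n). split.
  - now apply sparse_singleton.
  - exists n. split; [apply Nat.eqb_refl|]. now apply (eval_true X Y).
Qed.

(** Both kinds of requirement range over countable types, so one [A] meets them all. The second kind
    serves the sets [B] that do not split every reservoir. *)
Lemma dense_set_avoiding_reservoirs (R : list data -> cantor) :
  exists A, Rbar_lt (Finite 0) (lower_density A) /\ avoids R A /\
    forall l u e, has_sparse (hit_by (tail u (R l)) e) ->
      exists n, A n = false /\ eval (tail u (R l)) e n 1.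
Proof.
  destruct (countable_surjection ((list data * data) + (list data * nat * code))
    (inr ([], 0, cZero))) as [req Hreq].
  { apply countable_sum; repeat apply countable_prod; try apply countable_list;
      repeat apply countable_prod;
      auto using countable_nat, countable_code, countable_list. }
  destruct (dense_set_avoiding (fun r => match req r with
    | inl (l, d) => unavoidable (R l) d
    | inr (l, u, e) => hit_by (tail u (R l)) e end)) as [A [HA HU]].
  exists A. split; [assumption|]. split.
  - intros l d H. destruct (Hreq (inl (l, d))) as [r Hr].
    specialize (HU r). rewrite Hr in HU. now apply HU.
  - intros l u e H. destruct (Hreq (inr (l, u, e))) as [r Hr].
    specialize (HU r). rewrite Hr in HU. destruct (HU H) as [W [[n [Wn Hn]] HW]].
    exists n. split; auto.
Qed.

Theorem theorem7p5 : ~ soc_le SD RT12.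
Proof.
  intros Hsoc.
  destruct reservoirs as [R [Rinf [Rsub Rsil]]].
  destruct (dense_set_avoiding_reservoirs R) as [A [HA [Hav Himm]]].
  destruct (Hsoc A HA) as [B [_ HB]]. simpl in HB.
  assert (HB' : forall C c, infinite C -> subset C (side B c) ->
    exists Y e, infinite Y /\ subset Y A /\ forall n, eval C e n (Nat.b2n (Y n))).
  { intros C c HC HCB. destruct (HB C) as [Y [[e He] [HY HYA]]].
    - split; [assumption|]. destruct c; auto.
    - now exists Y, e. }
  destruct (classic (splits R B)) as [Hsp|Hsp].
  - destruct (generic_pair R A B Rsub Rsil Hav Hsp) as [G [HG HF]].
    (* The reduction yields a code for each side; together they form one of the pairs handled by
       [G]. *)
    destruct (functional_choice (fun c e => exists Y, infinite Y /\ subset Y A /\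
      forall n, eval (G c) e n (Nat.b2n (Y n)))) as [e He].
    { intros c. destruct (HG c) as [H1 H2]. destruct (HB' _ c H1 H2) as [Y [e H]].
      now exists e, Y. }
    destruct (HF e) as [c Hc]. destruct (He c) as [Y [HY [HYA HYe]]].
    destruct Hc as [[n [An Hn]]|[m Hm]].
    + apply (eval_true _ _ _ _ HYe), HYA in Hn. congruence.
    + destruct (HY m) as [n [Hn Yn]]. apply (Hm n Hn). now apply (eval_true _ _ _ _ HYe).
  - apply not_all_ex_not in Hsp. destruct Hsp as [l Hsp].
    apply not_all_ex_not in Hsp. destruct Hsp as [u Hsp].
    apply not_all_ex_not in Hsp. destruct Hsp as [c Hsp].
    (* Side [c] misses this tail, so the tail is a solution on the other side. *)
    destruct (HB' (tail u (R l)) (negb c)) as [Y [e [HY [HYA HYe]]]].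
    + apply infinite_tail, Rinf.
    + intros x Hx. unfold tail in Hx. apply andb_prop in Hx. destruct Hx as [Hu Hx].
      apply Nat.leb_le in Hu. apply Bool.not_false_is_true. intros Hneg. apply Hsp.
      exists x. repeat split; try assumption.
      destruct c; unfold side, compl in *; simpl in *; now destruct (B x).
    + destruct (Himm l u e) as [n [An Hn]].
      * now apply has_sparse_hit_by with Y.
      * apply (eval_true _ _ _ _ HYe), HYA in Hn. congruence.
Qed.
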